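(* For type $C$, let $\mathcal C_r=\{\sigma\in W_r:\wp(\sigma(\tilde\alpha+\rho)-\rho)>0\}$ be the Weyl alternation set of the Lie algebra of type $C_r$ ($r\ge 2$); let $P_1=\{1\}$ and, for $r\ge 2$, let $P_r$ be the set of all elements of $\mathcal C_r$ which do not contain a factor of $s_r$. Then for every $r\ge 2$, \[|\mathcal C_r|=|P_r|+|P_{r-1}|.\]
   Context: Type $C_r$ ($\mathfrak{sp}_{2r}(\mathbb C)$, $r\ge 2$): simple roots $\alpha_i=\varepsilon_i-\varepsilon_{i+1}$ for $1\le i\le r-1$ and $\alpha_r=2\varepsilon_r$; positive roots $\Phi^+=\{\varepsilon_i-\varepsilon_j,\varepsilon_i+\varepsilon_j:1\le i<j\le r\}\cup\{2\varepsilon_i:1\le i\le r\}$; highest root $\tilde\alpha=2\alpha_1+2\alpha_2+\cdots+2\alpha_{r-1}+\alpha_r$ $(=2\varepsilon_1)$; $\rho=\frac12\sum_{\alpha\in\Phi^+}\alpha$. $s_i$ denotes the simple reflection in $\alpha_i$, and $W_r$ is the Weyl group generated by $s_1,\dots,s_r$. $\wp(\xi)$ is Kostant's partition function: the number of ways $\xi$ may be written as a nonnegative integral sum of positive roots. An element of $W_r$ contains a factor of $s_r$ if $s_r$ occurs in a (equivalently, every) reduced expression for it. *)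

(* Defs.v *)
From mathcomp Require Import all_boot all_order all_algebra.
From mathcomp Require Import finmap.
From mathcomp Require Import ring.
From mathcomp Require Import mathcomp_extra boolp classical_sets functions
  cardinality.

Set Implicit Arguments.
Unset Strict Implicit.
Unset Printing Implicit Defensive.

Import Order.TTheory GRing.Theory Num.Theory.

Local Open Scope classical_set_scope.
Local Open Scope ring_scope.

(* Weights live in the rational span of e_1, ..., e_r, as column vectors.
   Indices start at 0: [eps r k] is e_(k+1), and [alpha i] is alpha_(i+1). *)
Definition eps (r k : nat) : 'cV[rat]_r := \col_j ((j : nat) == k)%:R.

Definition alpha (r : nat) (i : 'I_r) : 'cV[rat]_r :=
  if (i.+1 < r)%N then eps r i - eps r i.+1 else eps r i *+ 2.

Definition pos_roots (r : nat) : {fset 'cV[rat]_r} :=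
  let lt_pairs := [pred p : 'I_r * 'I_r | (p.1 < p.2)%N] in
  ([fset (eps r p.1 - eps r p.2)%R | p : 'I_r * 'I_r in lt_pairs]
   `|` [fset (eps r p.1 + eps r p.2)%R | p : 'I_r * 'I_r in lt_pairs]
   `|` [fset (eps r i *+ 2)%R | i : 'I_r in 'I_r])%fset.

Definition highest_root (r : nat) : 'cV[rat]_r :=
  \sum_(i < r) alpha i *+ (if (i.+1 < r)%N then 2 else 1).

Definition rho (r : nat) : 'cV[rat]_r := 2^-1 *: \sum_(a : pos_roots r) val a.

Definition dot (r : nat) (u v : 'cV[rat]_r) : rat := (u^T *m v) 0 0.

(* The matrix of v |-> v - 2 (v, alpha_i) / (alpha_i, alpha_i) alpha_i. *)
Definition srefl (r : nat) (i : 'I_r) : 'M[rat]_r :=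
  1%:M - (2 / dot (alpha i) (alpha i)) *: (alpha i *m (alpha i)^T).

Definition word_prod (r : nat) (w : seq 'I_r) : 'M[rat]_r :=
  \prod_(i <- w) srefl i.

(* Each simple reflection is an involution, so the group they generate is the
   set of their finite products. *)
Definition weyl (r : nat) : set 'M[rat]_r := range (@word_prod r).
Arguments weyl r _ : clear implicits.

Definition reduced (r : nat) (sigma : 'M[rat]_r) (w : seq 'I_r) : Prop :=
  word_prod w = sigma /\
  forall w' : seq 'I_r, word_prod w' = sigma -> (size w <= size w')%N.

Definition contains_factor (r : nat) (sigma : 'M[rat]_r) (i : 'I_r) : Prop :=
  exists2 w : seq 'I_r, reduced sigma w & i \in w.

Definition kostant_decomp (r : nat) (xi : 'cV[rat]_r)
  : set {ffun pos_roots r -> nat} :=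
  [set m | \sum_(a : pos_roots r) val a *+ m a = xi].

(* [fset_set] is empty on infinite sets; see [finite_kostant_decomp] and
   [finite_weyl]. *)
Definition kostant (r : nat) (xi : 'cV[rat]_r) : nat :=
  #|` fset_set (kostant_decomp xi)|.

Definition alternation_set (r : nat) : set 'M[rat]_r :=
  [set sigma | weyl r sigma /\
     (0 < kostant (sigma *m (highest_root r + rho r) - rho r))%N].
Arguments alternation_set r _ : clear implicits.

(* P_1 = {1} is a convention; P_0 is never used. *)
Definition P_set (r : nat) : set 'M[rat]_r :=
  if r == 1%N then [set 1%:M] else
  [set sigma | alternation_set r sigma /\
     forall i : 'I_r, i.+1 = r -> ~ contains_factor sigma i].
Arguments P_set r _ : clear implicits.

Lemma srefl_tr (r : nat) (i : 'I_r) : (srefl i)^T = srefl i.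
Proof. by rewrite /srefl linearB /= trmx1 linearZ /= trmx_mul trmxK. Qed.

Lemma srefl_sqr (r : nat) (i : 'I_r) : srefl i *m srefl i = 1%:M.
Proof.
rewrite /srefl; set a := alpha i; set d := dot a a.
have aa : a *m a^T *m (a *m a^T) = d *: (a *m a^T).
  rewrite mulmxA -(mulmxA a) [a^T *m a]mx11_scalar mul_mx_scalar.
  by rewrite -scalemxAl.
have [d0|d0] := eqVneq d 0.
  by rewrite d0 invr0 mulr0 scale0r subr0 mulmx1.
rewrite mulmxBl mul1mx mulmxBr mulmx1 -scalemxAl -scalemxAr aa !scalerA.
have -> : 2 / d * (2 / d) * d = 2 / d + 2 / d.
  by rewrite -mulrA divfK// mulr_natr mulr2n.
by rewrite scalerDl opprB addrK subrK.
Qed.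

Lemma dot_eps (r k l : nat) : (k < r)%N ->
  dot (eps r k) (eps r l) = (k == l)%:R.
Proof.
move=> kr; rewrite /dot mxE (bigD1 (Ordinal kr)) //= big1 => [|j jk].
  by rewrite addr0 !mxE eqxx mul1r.
rewrite !mxE; case: eqP => [e|_]; last by rewrite mul0r.
by case/eqP: jk; apply/val_inj.
Qed.

Lemma dot_alpha (r : nat) (i : 'I_r) :
  dot (alpha i) (alpha i) = if (i.+1 < r)%N then 2 else 4.
Proof.
have dotE (u v : 'cV[rat]_r) : dot u v = \sum_j u j ord0 * v j ord0.
  by rewrite /dot mxE; apply: eq_bigr => j _; rewrite mxE.
have dotD (u v w z : 'cV[rat]_r) :
    dot (u + v) (w + z) = dot u w + dot u z + (dot v w + dot v z).
  rewrite !dotE -!big_split; apply: eq_bigr => j _.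
  by rewrite !mxE mulrDl !mulrDr.
have dotNl (u v : 'cV[rat]_r) : dot (- u) v = - dot u v.
  by rewrite !dotE -sumrN; apply: eq_bigr => j _; rewrite mxE mulNr.
have dotNr (u v : 'cV[rat]_r) : dot u (- v) = - dot u v.
  by rewrite !dotE -sumrN; apply: eq_bigr => j _; rewrite mxE mulrN.
rewrite /alpha; case: ifP => ir; rewrite ?mulr2n dotD ?dotNl ?dotNr !dot_eps//.
  by rewrite !eqxx eqn_leq ltnn andbF eqn_leq ltnn.
by rewrite eqxx.
Qed.

Lemma srefl_int (r : nat) (i j k : 'I_r) : srefl i j k \is a Num.int.
Proof.
have E x l : eps r x l ord0 \is a Num.int by rewrite mxE; exact: natr_int.
have Z (v : 'cV[rat]_r) : (v *m v^T) j k = v j ord0 * v k ord0.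
  by rewrite mxE big_ord1 mxE.
have -> : srefl i j k = (j == k)%:R - (2 / dot (alpha i) (alpha i)) *
    (alpha i j ord0 * alpha i k ord0) by rewrite -Z !mxE.
rewrite dot_alpha rpredB ?natr_int// /alpha; case: ifP => _.
  have B x y l : (eps r x - eps r y) l ord0 \is a Num.int.
    by rewrite !mxE rpredB ?natr_int.
  by rewrite divff// mul1r rpredM.
have D x l : (eps r x *+ 2) l ord0 = 2 * eps r x l ord0.
  by rewrite mulr2n mxE mulr_natl.
have -> : 2 / 4 * ((eps r i *+ 2) j ord0 * (eps r i *+ 2) k ord0) =
    2 * (eps r i j ord0 * eps r i k ord0).
  by rewrite !D; field.
by rewrite !rpredM ?natr_int.
Qed.

Lemma finite_weyl (r : nat) : finite_set (weyl r).
Proof.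
pose f (A : 'M['I_3]_r) : 'M[rat]_r := map_mx (fun x : 'I_3 => (x : nat)%:R - 1) A.
apply: (@sub_finite_set _ _ (range f)); last exact/finite_image/finite_finset.
move=> _ [w _ <-].
have [Zw Ow] : (forall i j, word_prod w i j \is a Num.int) /\
    word_prod w *m (word_prod w)^T = 1%:M.
  elim: w => [|i w [Zw Ow]]; rewrite /word_prod ?big_nil ?big_cons.
    by split=> [i j|]; rewrite ?trmx1 ?mulmx1// mxE natr_int.
  split=> [j k|].
    rewrite mxE rpred_sum// => l _; rewrite rpredM ?Zw//; exact: srefl_int.
  rewrite -[_ * _]/(srefl i *m word_prod w) trmx_mul mulmxA.
  by rewrite -(mulmxA (srefl i)) Ow mulmx1 srefl_tr srefl_sqr.
pose M := word_prod w; rewrite -/M in Zw Ow *.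
have M1 i j : `|M i j| <= 1.
  have S1 : \sum_k M i k * M^T k i = 1.
    by have := congr1 (fun A : 'M[rat]_r => A i i) Ow; rewrite !mxE eqxx.
  rewrite -(@ler_pXn2r _ 2) ?nnegrE// expr1n -S1 (bigD1 j)//= mxE.
  rewrite -normrX ger0_norm ?sqr_ge0// expr2 lerDl.
  by apply: sumr_ge0 => k _; rewrite mxE -expr2 sqr_ge0.
have N3 i j : exists x : 'I_3, (x : nat)%:R - 1 = M i j.
  have := M1 i j; have /intrP[m ->] := Zw i j.
  rewrite -intr_norm -[1]/(1%:~R) ler_int.
  case: m => [[|[|//]]|[|//]] _.
  - by exists (inord 1); rewrite inordK.
  - by exists (inord 2); rewrite inordK.
  - by exists (inord 0); rewrite inordK.
exists (\matrix_(i, j) sval (cid (N3 i j))) => //.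
by apply/matrixP=> i j; rewrite !mxE; case: cid.
Qed.

Lemma finite_kostant_decomp (r : nat) (xi : 'cV[rat]_r) :
  finite_set (kostant_decomp xi).
Proof.
pose h (v : 'cV[rat]_r) : rat := \sum_(j < r) (r - j)%:R * v j ord0.
have hD u v : h (u + v) = h u + h v.
  by rewrite -big_split; apply: eq_bigr => j _; rewrite mxE mulrDr.
have h0 : h 0 = 0 by rewrite /h big1// => j _; rewrite mxE mulr0.
have hN u : h (- u) = - h u.
  by apply/eqP; rewrite -addr_eq0 -hD addNr h0.
have hM u n : h (u *+ n) = h u *+ n.
  by elim: n => [|n IH]; rewrite ?h0// !mulrS hD IH.
have he (k : 'I_r) : h (eps r k) = (r - k)%:R.
  rewrite /h (bigD1 k)//= big1 ?addr0 ?mxE ?eqxx ?mulr1// => j jk.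
  by rewrite mxE (_ : _ == _ = false) ?mulr0//; apply/negbTE.
have he1 (k : 'I_r) : 1 <= h (eps r k).
  by rewrite he -[1]/(1%:R) ler_nat subn_gt0.
have hroot (a : pos_roots r) : 1 <= h (val a).
  have := valP a; rewrite !in_fsetU => /orP[/orP[]|] /imfsetP[p /= pP ->].
  - rewrite hD hN !he -natrB ?leq_sub2l//; last exact: ltnW.
    rewrite -[1]/(1%:R) ler_nat subn_gt0 ltn_sub2l//.
  - by rewrite hD (le_trans (he1 p.1))// lerDl (le_trans _ (he1 p.2)).
  - by rewrite hM mulr2n (le_trans (he1 p))// lerDl (le_trans _ (he1 p)).
have hS (m : {ffun pos_roots r -> nat}) : kostant_decomp xi m ->
    \sum_a h (val a) *+ m a = h xi.
  move=> <-; rewrite (big_morph h hD h0).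
  by apply: eq_bigr => a _; rewrite hM.
pose N := Num.truncn (h xi).
pose g (m : {ffun pos_roots r -> 'I_N.+1}) : {ffun pos_roots r -> nat} :=
  [ffun a => m a : nat].
apply: (@sub_finite_set _ _ (range g)); last exact/finite_image/finite_finset.
move=> m /hS mxi; exists [ffun a => inord (m a)] => //.
apply/ffunP => a; rewrite !ffunE inordK// ltnS /N.
have le_ma : (m a)%:R <= h xi.
  rewrite -mxi (bigD1 a)//= (@le_trans _ _ (h (val a) *+ m a))//.
    by rewrite -[leRHS]mulr_natl ler_peMr.
  rewrite lerDl sumr_ge0// => b _; rewrite mulrn_wge0//.
  by rewrite (le_trans _ (hroot b)).
by rewrite truncn_ge_nat// (le_trans _ le_ma).
Qed.

(* Main.v *)
Require Import Defs.
From mathcomp Require Import all_boot all_order all_algebra all_fingroup.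
From mathcomp Require Import finmap lra zify.
From mathcomp Require Import mathcomp_extra boolp classical_sets functions
  cardinality.

(** Write [lambda] for the highest root plus [rho], so that
    [lambda = (r + 2, r - 1, ..., 1)] while [rho = (r, r - 1, ..., 1)], and
    recall that the Weyl group acts by signed permutations of the coordinates.

    An integral vector with even coordinate sum is a sum of positive roots
    exactly when its prefix sums are nonnegative: these prefix sums are, up to a
    factor 2 at the last place, its coordinates on the simple roots
    ([kostant_gt0_prefix]). Hence [sigma] lies in the alternation set iff every
    prefix sum of [sigma lambda - rho], its [excess], is nonnegative.

    The coordinates of [lambda] sum to only 2 more than those of [rho], and
    negating the entry [a] lowers the sum by [2 a]. So at most the entry 1 can
    be negated, and then the total excess is 0, which forces that entry to sit
    in the last place ([excess_negative]). The alternation set therefore splits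
    into two disjoint parts:
    - the elements that negate nothing. Forgetting signs is a homomorphism to
      the symmetric group that kills [s_r] and fixes the other simple
      reflections, so deleting the letters [s_r] from a word of a permutation
      gives a shorter word of the same permutation. These elements are therefore
      those without factor [s_r] ([no_last_factor]), that is, [P_r];
    - the elements that negate exactly the last entry, which is 1. Removing that
      entry and subtracting 1 from all the others turns [lambda] and [rho] into
      their analogues in rank [r - 1], without changing the differences. What
      remains is an unsigned permutation, so this part is in bijection with
      [P_(r-1)] ([excess_lift], [alternation_set_split]).

    Both bijections are expressed through the set [dominating n] of the
    permutations whose excess is nonnegative: [P_n] is the set of their
    permutation matrices ([P_setE]). *)

Set Implicit Arguments.
Unset Strict Implicit.
Unset Printing Implicit Defensive.

Import Order.TTheory GRing.Theory Num.Theory.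

Section WeylAlternation.
Local Open Scope classical_set_scope.
Local Open Scope ring_scope.

(** * The coordinates of [rho] and of the highest root *)

Lemma big_fsetU_disjoint (K : choiceType) (V : nmodType) (A B : {fset K})
    (F : K -> V) : (forall x, x \in A -> x \notin B) ->
  \sum_(x <- (A `|` B)%fset) F x = \sum_(x <- A) F x + \sum_(x <- B) F x.
Proof.
move=> AB; rewrite -big_cat; apply/perm_big/uniq_perm.
- exact: fset_uniq.
- rewrite cat_uniq !fset_uniq/= andbT; apply/hasPn => x xB; apply/negP => /AB.
  by rewrite xB.
- by move=> x; rewrite in_fsetU mem_cat.
Qed.

Lemma epsE r k (i : 'I_r) j : eps r k i j = ((i : nat) == k)%:R.
Proof. by rewrite mxE. Qed.

Lemma eps_sub_inj r : {in [pred p : 'I_r * 'I_r | (p.1 < p.2)%N] &,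
  injective (fun p : 'I_r * 'I_r => eps r p.1 - eps r p.2)}.
Proof.
move=> [i j] [i' j']; rewrite !inE /= => ij ij' /matrixP E.
have -> : i = i'.
  apply: val_inj; have := E i ord0; rewrite !mxE eqxx (ltn_eqF ij).
  by case: (eqVneq (i : nat) i') => [//|_]; case: eqP => _ /eqP.
congr pair; apply: val_inj; have := E j ord0; rewrite !mxE eqxx (gtn_eqF ij).
by case: (eqVneq (j : nat) j') => [//|_]; case: eqP => _ /eqP.
Qed.

Lemma eps_add_inj r : {in [pred p : 'I_r * 'I_r | (p.1 < p.2)%N] &,
  injective (fun p : 'I_r * 'I_r => eps r p.1 + eps r p.2)}.
Proof.
move=> [i j] [i' j']; rewrite !inE /= => ij ij' /matrixP E.
have ii' : i = i'.
  apply: val_inj; have := E i ord0; rewrite !mxE eqxx (ltn_eqF ij).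
  case: (eqVneq (i : nat) i') => [//|ne]; case: eqP => [e _|_ /eqP //].
  have := E i' ord0; rewrite !mxE eqxx (ltn_eqF ij') eq_sym (negbTE ne).
  by case: eqP => [|_ /eqP //]; lia.
rewrite -ii' in E *; congr pair; apply: val_inj; have := E j ord0.
rewrite !mxE eqxx (gtn_eqF ij).
by case: (eqVneq (j : nat) j') => [//|_ /eqP].
Qed.

Lemma eps_dbl_inj r : injective (fun i : 'I_r => eps r i *+ 2).
Proof.
move=> i j /matrixP/(_ i ord0); rewrite !mulr2n !mxE eqxx.
by case: (eqVneq (i : nat) j) => [/val_inj//|_ /eqP].
Qed.

(** [pos_roots] is a set, so summing over the index pairs needs that distinct
    indices give distinct roots. Pairing [e_i - e_j] with [e_i + e_j] then
    leaves [e_i *+ 2]. *)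
Lemma sum_pos_roots r : \sum_(a : pos_roots r) val a =
  \sum_(p : 'I_r * 'I_r | (p.1 < p.2)%N) eps r p.1 *+ 2 +
  \sum_(i < r) eps r i *+ 2.
Proof.
rewrite -(big_seq_fsetE _ _ xpredT id) /=.
rewrite !big_fsetU_disjoint; first last.
(* The coordinate at the larger index j of e_i + e_j or e_i - e_j is odd, which
   excludes a long root; in e_i - e_j it is negative, which excludes a sum. *)
- move=> x; rewrite in_fsetU => xA; apply/negP => /imfsetP[k' /= _ xk].
  move: xA; rewrite xk => /orP[] /imfsetP[[i j] /=]; rewrite inE /= => ij;
  move/matrixP => /(_ j ord0); rewrite !mulr2n !mxE !eqxx (gtn_eqF ij);
  by case: eqP => _ /eqP.
- move=> x /imfsetP[[i j] /= ij ->]; apply/negP => /imfsetP[[i' j'] /= ij'].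
  move/matrixP=> /(_ j ord0); move: ij ij'; rewrite !inE/= => ij ij'.
  by rewrite !mxE eqxx (gtn_eqF ij); do 2!case: eqP => _; move/eqP.
rewrite !big_imfset //=; first last.
- exact: eps_sub_inj.
- exact: eps_add_inj.
- by move=> ? ? _ _; exact: eps_dbl_inj.
rewrite !big_enum_cond /= -big_split /=; congr (_ + _).
apply: eq_big => [p|p _]; first by rewrite andbT.
by rewrite addrACA addNr addr0 mulr2n.
Qed.

Lemma card_ord_gt r k : (k < r)%N -> (\sum_(j < r | k < j) 1 = r - k.+1)%N.
Proof.
elim: r => // r IH; rewrite ltnS leq_eqVlt.
rewrite big_mkcond big_ord_recr -big_mkcond /=.
move=> /orP[/eqP <-|kr]; last by rewrite (IH kr) kr; lia.
rewrite ltnn subnn addn0 big_pred0 // => i.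
by rewrite ltnNge (ltnW (ltn_ord i)).
Qed.

Lemma rhoE r (k : 'I_r) : rho r k ord0 = (r - k)%:R.
Proof.
have E (i : 'I_r) n : (eps r i *+ n) k ord0 = (k == i)%:R *+ n.
  by rewrite -scaler_nat !mxE mulr_natl.
rewrite /rho sum_pos_roots mxE.
rewrite -(pair_big_dep xpredT (fun i j : 'I_r => (i < j)%N)
            (fun i _ => eps r i *+ 2)) /= -big_split /=.
under eq_bigr => i _.
  have -> : \sum_(j < r | (i < j)%N) eps r i *+ 2 = eps r i *+ 2 *+ (r - i.+1).
    rewrite -card_ord_gt // -sumrMnr; exact: eq_bigr.
  rewrite -mulrSr -mulrnA subnSK //.
  over.
rewrite summxE (bigD1 k) //= big1 => [|i ik]; last first.
  by rewrite E eq_sym (negbTE ik) mul0rn.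
by rewrite E eqxx addr0 /= natrM mulrA mulVf ?mul1r.
Qed.

(** An index out of range gives the zero vector. Each term of the highest root,
    also the last one, is therefore [eps r i *+ 2 - eps r i.+1 *+ 2], and the
    sum telescopes in [highest_rootE]. *)
Lemma eps_out r : eps r r = 0.
Proof. by apply/matrixP => j l; rewrite !mxE ltn_eqF. Qed.

Lemma highest_rootE r (k : 'I_r) :
  highest_root r k ord0 = ((k == 0%N :> nat).*2)%:R.
Proof.
have -> : highest_root r =
    - \sum_(0 <= i < r) (eps r i.+1 *+ 2 - eps r i *+ 2).
  rewrite big_mkord -sumrN; apply: eq_bigr => i _; rewrite opprB /alpha.
  case: (ltngtP i.+1 r) (ltn_ord i) => // [_|->] _; first by rewrite mulrnBl.
  by rewrite eps_out mul0rn subr0.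
rewrite (telescope_sumr (fun i => eps r i *+ 2)) // eps_out mul0rn opprB subr0.
by rewrite -scaler_nat !mxE -natrM mul2n.
Qed.

(** * Prefix sums decide positivity of the partition function *)

Definition prefix r (k : nat) (v : 'cV[rat]_r) : rat :=
  \sum_(i < r | (i < k)%N) v i ord0.

Lemma prefixD r k : {morph @prefix r k : u v / u + v}.
Proof.
by move=> u v; rewrite -big_split; apply: eq_bigr => i _; rewrite mxE.
Qed.

Lemma prefix0 r k : prefix k (0 : 'cV_r) = 0.
Proof. by rewrite /prefix big1 // => i _; rewrite mxE. Qed.

Lemma prefixN r k : {morph @prefix r k : u / - u}.
Proof. by move=> u; rewrite -sumrN; apply: eq_bigr => i _; rewrite mxE. Qed.

Lemma prefixMn r k n : {morph @prefix r k : u / u *+ n}.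
Proof.
by move=> u; elim: n => [|n IH]; rewrite ?prefix0 // !mulrS prefixD IH.
Qed.

Lemma prefix_eps r k (i : 'I_r) : prefix k (eps r i) = (i < k)%:R.
Proof.
rewrite /prefix big_mkcond (bigD1 i) //= big1 ?addr0 ?epsE ?eqxx => [|j ji].
  by case: ifP.
by rewrite epsE (inj_eq val_inj) (negbTE ji) if_same.
Qed.

Lemma prefixS r (i : 'I_r) v : prefix i.+1 v = prefix i v + v i ord0.
Proof.
rewrite /prefix (bigD1 i) //= addrC; congr (_ + _).
by apply: eq_bigl => j; rewrite ltnS ltn_neqAle andbC.
Qed.

Lemma prefix_out r k (v : 'cV_r) : (r <= k)%N -> prefix k v = prefix r v.
Proof.
move=> rk; apply: eq_bigl => i.
by rewrite ltn_ord (leq_trans (ltn_ord i)).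
Qed.

Lemma prefix_inj r (u v : 'cV_r) :
  (forall i : 'I_r, prefix i.+1 u = prefix i.+1 v) -> u = v.
Proof.
move=> uv; apply/matrixP => i j; rewrite (ord1 j).
have E : prefix i u = prefix i v.
  case: i => [[|k] kr] /=; first by rewrite /prefix !big_pred0.
  exact: (uv (Ordinal (ltnW kr))).
by have := uv i; rewrite !prefixS E => /addrI.
Qed.

Lemma prefix_pos_root r k a : a \in pos_roots r -> 0 <= prefix k a.
Proof.
rewrite !in_fsetU => /orP[/orP[]|] /imfsetP[p /= pP ->].
- rewrite prefixD prefixN !prefix_eps subr_ge0 ler_nat.
  by move: pP; rewrite inE /=; do 2 case: ltnP => //; lia.
- by rewrite prefixD !prefix_eps addr_ge0.
- by rewrite prefixMn prefix_eps mulrn_wge0.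
Qed.

Lemma alpha_pos_root r (i : 'I_r) : alpha i \in pos_roots r.
Proof.
rewrite /alpha !in_fsetU; case: ifP => ir.
  apply/orP; left; apply/orP; left; apply/imfsetP.
  by exists (i, Ordinal ir); rewrite //= inE /=.
by apply/orP; right; apply/imfsetP; exists i.
Qed.

(** The prefix sums are dual to the simple roots, up to the factor 2 on the
    long one. *)
Lemma prefix_alpha r (i j : 'I_r) :
  prefix j.+1 (alpha i) = (i == j)%:R * (if (i.+1 < r)%N then 1 else 2).
Proof.
rewrite /alpha; case: ifP => ir.
  rewrite prefixD prefixN (prefix_eps _ (Ordinal ir)) prefix_eps /= mulr1 !ltnS.
  by rewrite -val_eqE /=; case: ltngtP.
rewrite prefixMn prefix_eps ltnS mulr_natr; congr (_%:R *+ _).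
by have := ltn_ord j; have := ltn_ord i; rewrite -val_eqE /=; lia.
Qed.

Lemma kostant_gt0P r (xi : 'cV[rat]_r) :
  (0 < kostant xi)%N <->
  exists m : {ffun pos_roots r -> nat}, \sum_a val a *+ m a = xi.
Proof.
rewrite /kostant cardfs_gt0; split.
  case/fset0Pn => m; rewrite in_fset_set; last exact: finite_kostant_decomp.
  by rewrite inE => mP; exists m.
case=> m mP; apply/fset0Pn; exists m.
by rewrite in_fset_set ?inE //; exact: finite_kostant_decomp.
Qed.

(** Prefix sums are nonnegative on every positive root. Conversely, divided by
    the factor of [prefix_alpha], they are the coordinates on the simple roots,
    and those are positive roots. Evenness of the sum is what makes the
    coordinate on the long root an integer. *)
Lemma kostant_gt0_prefix r (xi : 'cV[rat]_r) :
  (forall i, xi i ord0 \is a Num.int) -> prefix r xi / 2 \is a Num.int ->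
  (0 < kostant xi)%N <-> forall k, 0 <= prefix k xi.
Proof.
move=> xiZ totZ; rewrite kostant_gt0P; split.
  case=> m <- k; rewrite (big_morph _ (@prefixD r k) (@prefix0 r k)).
  apply: sumr_ge0 => a _.
  by rewrite prefixMn mulrn_wge0 ?(prefix_pos_root _ (valP a)).
move=> xi0.
pose h (i : 'I_r) : rat := if (i.+1 < r)%N then 1 else 2.
pose c (i : 'I_r) := Num.truncn (prefix i.+1 xi / h i).
have cE i : (c i)%:R = prefix i.+1 xi / h i.
  rewrite /c truncnK // natrEint divr_ge0 //; last by rewrite /h; case: ifP.
  rewrite andbT /h; case: (ltngtP i.+1 r) (ltn_ord i) => // [_ _|-> _].
    by rewrite divr1 rpred_sum.
  by [].
have -> : xi = \sum_i alpha i *+ c i.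
  apply: prefix_inj => j.
  rewrite (big_morph _ (@prefixD r j.+1) (@prefix0 r j.+1)) (bigD1 j) //=.
  rewrite big1 => [|i ij]; rewrite prefixMn prefix_alpha.
    rewrite eqxx mul1r addr0 -[RHS]mulr_natr cE /h mulrC divfK //.
    by case: ifP.
  by rewrite (negbTE ij) mul0r mul0rn.
exists [ffun a => \sum_(i | val a == alpha i) c i]%N.
under eq_bigr => a _ do rewrite ffunE -sumrMnr.
rewrite (exchange_big_dep xpredT) //=; apply: eq_bigr => i _.
rewrite (bigD1 [` alpha_pos_root i]%fset) //= big1 ?addr0 // => a.
by case/andP => /eqP ai /eqP []; apply: val_inj.
Qed.

(** * The Weyl group as signed permutations *)

Definition signed_perm_mx r (d : 'I_r -> bool) (s : 'S_r) : 'M[rat]_r :=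
  \matrix_(i, j) ((-1) ^+ d i * (s i == j)%:R).

Lemma signed_perm_mx_pos r (s : 'S_r) :
  signed_perm_mx (fun=> false) s = perm_mx s.
Proof. by apply/matrixP => i j; rewrite !mxE mul1r. Qed.

Lemma signed_perm_mxM r (d e : 'I_r -> bool) (s t : 'S_r) :
  signed_perm_mx d s *m signed_perm_mx e t =
  signed_perm_mx (fun i => d i (+) e (s i)) (s * t).
Proof.
apply/matrixP => i j; rewrite !mxE (bigD1 (s i)) //= big1 => [|k ki].
  by rewrite !mxE eqxx permM signr_addb mulr1 mulrA addr0.
by rewrite !mxE eq_sym (negbTE ki) mulr0 mul0r.
Qed.

Lemma signed_perm_mx_mulv r (d : 'I_r -> bool) (s : 'S_r) (v : 'cV[rat]_r) i :
  (signed_perm_mx d s *m v) i ord0 = (-1) ^+ d i * v (s i) ord0.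
Proof.
rewrite mxE (bigD1 (s i)) //= big1 => [|k ki].
  by rewrite !mxE eqxx mulr1 addr0.
by rewrite !mxE eq_sym (negbTE ki) mulr0 mul0r.
Qed.

Lemma signed_perm_mx_inj r (d e : 'I_r -> bool) (s t : 'S_r) :
  signed_perm_mx d s = signed_perm_mx e t -> d =1 e /\ s = t.
Proof.
move=> /matrixP E.
have E1 i : t i = s i.
  have := E i (s i); rewrite !mxE eqxx; case: eqP => // _.
  by case: (d i); case: (e i) => /eqP.
split=> [i|]; last by apply/permP => i; rewrite E1.
have := E i (s i); rewrite !mxE E1 eqxx.
by case: (d i); case: (e i) => /eqP.
Qed.

Lemma srefl_tperm r (i j : 'I_r) : i.+1 = j :> nat ->
  srefl i = perm_mx (tperm i j).
Proof.
move=> ij; have ir : (i.+1 < r)%N by rewrite ij.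
apply/matrixP => k l; rewrite /srefl dot_alpha ir divff // scale1r /alpha ir.
rewrite ij !mxE big_ord1 !mxE !(inj_eq val_inj).
have nij : (i == j) = false by apply/eqP => e; move: ij; rewrite e; lia.
case: tpermP => [->|->|/eqP ki /eqP kj].
- by rewrite eqxx nij !(eq_sym l); case: (eqVneq i l) => [<-|_];
    rewrite ?(eq_sym j) ?nij; do ?case: eqP => _.
- by rewrite eqxx (eq_sym j i) nij !(eq_sym l); case: (eqVneq j l) => [<-|_];
    rewrite ?nij; do ?case: eqP => _.
- by rewrite (negbTE ki) (negbTE kj) subrr mul0r subr0.
Qed.

Lemma srefl_last r (i : 'I_r) : i.+1 = r ->
  srefl i = signed_perm_mx (pred1 i) 1.
Proof.
move=> ir; apply/matrixP => k l.
rewrite /srefl dot_alpha /alpha ir ltnn mulr2n !mxE big_ord1 !mxE.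
rewrite !(inj_eq val_inj) perm1 /=.
case: (eqVneq k i) => [->|_]; last by rewrite mul1r addr0 mul0r mulr0 subr0.
by rewrite (eq_sym l); case: eqP => _.
Qed.

Lemma word_prod_cat r (w1 w2 : seq 'I_r) :
  word_prod (w1 ++ w2) = word_prod w1 *m word_prod w2.
Proof. by rewrite /word_prod big_cat. Qed.

Lemma word_prod_cons r i (w : seq 'I_r) :
  word_prod (i :: w) = srefl i *m word_prod w.
Proof. by rewrite /word_prod big_cons. Qed.

Definition nonlast r (i : 'I_r) := (i.+1 < r)%N.

(** Forgetting signs maps the product of a word to that of the word without its
    letters [s_r], since [s_r] only changes a sign. *)
Lemma word_prod_signed_perm r (w : seq 'I_r) : exists d s,
  word_prod w = signed_perm_mx d s /\
  word_prod (filter (@nonlast r) w) = perm_mx s.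
Proof.
elim: w => [|i w [d [s [ws ws']]]].
  exists (fun=> false), 1%g; rewrite /word_prod !big_nil signed_perm_mx_pos.
  by rewrite perm_mx1.
rewrite word_prod_cons /= /nonlast.
case: (ltngtP i.+1 r) (ltn_ord i) => // ir _.
  rewrite word_prod_cons ws ws' (srefl_tperm (j := Ordinal ir)) //.
  rewrite -perm_mxM -signed_perm_mx_pos signed_perm_mxM.
  by eexists; eexists; split.
rewrite ws ws' (srefl_last ir) signed_perm_mxM mul1g.
by eexists; eexists; split.
Qed.

(** The adjacent transpositions generate the symmetric group: a transposition
    [(i k+1)] is the conjugate of [(i k)] by [(k k+1)]. *)
Lemma perm_mx_word r (s : 'S_r) : exists2 w : seq 'I_r,
  all (@nonlast r) w & word_prod w = perm_mx s.
Proof.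
pose gen (s : 'S_r) := exists2 w : seq 'I_r,
  all (@nonlast r) w & word_prod w = perm_mx s.
rewrite -/(gen s).
have genM s1 s2 : gen s1 -> gen s2 -> gen (s1 * s2)%g.
  move=> [w1 n1 E1] [w2 n2 E2]; exists (w1 ++ w2); first by rewrite all_cat n1.
  by rewrite word_prod_cat E1 E2 perm_mxM.
have gen_adj (i j : 'I_r) : i.+1 = j :> nat -> gen (tperm i j).
  move=> ij; exists [:: i]; first by rewrite /= /nonlast ij ltn_ord.
  by rewrite word_prod_cons /word_prod big_nil mulmx1 (srefl_tperm ij).
have gen_lt n (i j : 'I_r) : (i + n).+1 = j :> nat -> gen (tperm i j).
  elim: n j => [|n IH] j ij; first by apply: gen_adj; rewrite -ij addn0.
  have kr : ((i + n).+1 < r)%N by rewrite -addnS (leq_trans _ (ltn_ord j)) -?ij.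
  pose k := Ordinal kr.
  have kj : gen (tperm k j) by apply: gen_adj; rewrite -ij addnS.
  have -> : tperm i j = (tperm k j * tperm i k * tperm k j)%g.
    rewrite -{1}(tpermV k j) -mulgA -conjgE tpermJ tpermL tpermD //.
      by rewrite -val_eqE /=; lia.
    by rewrite -val_eqE /=; lia.
  by apply: (genM _ _ (genM _ _ kj (IH k erefl)) kj).
have [ts -> tsP] := prod_tpermP s.
elim: ts tsP => [_|[i j] ts IH /= /andP[ij /IH gts]].
  by rewrite big_nil; exists [::]; rewrite // /word_prod big_nil perm_mx1.
rewrite big_cons; apply: genM gts => /=.
case: (ltngtP i j) => [lt|lt|/val_inj e].
- by apply: (gen_lt (j - i).-1); lia.
- by rewrite tpermC; apply: (gen_lt (i - j).-1); lia.
- by move: ij; rewrite /dpair /= e eqxx.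
Qed.

Lemma reduced_exists r (sigma : 'M[rat]_r) :
  weyl r sigma -> exists w, reduced sigma w.
Proof.
case=> w _ E.
have H : exists n,
    `[< exists2 w' : seq 'I_r, word_prod w' = sigma & size w' = n >].
  by exists (size w); apply/asboolP; exists w.
case: (ex_minnP H) => n /asboolP[w' E' <-] min; exists w'; split=> // v Ev.
by apply: min; apply/asboolP; exists v.
Qed.

(** In a reduced word of a permutation, removing the letters [s_r] preserves the
    product by [word_prod_signed_perm], so minimality of the length leaves no
    such letter to remove. *)
Lemma no_last_factor r (sigma : 'M[rat]_r) :
  (weyl r sigma /\ forall i : 'I_r, i.+1 = r -> ~ contains_factor sigma i) <->
  exists s : 'S_r, sigma = perm_mx s.
Proof.
split=> [[/reduced_exists[w wr] nf]|[s ->]].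
  have [d [s [E1 E2]]] := word_prod_signed_perm w.
  exists s; rewrite -E2 -(proj1 wr); congr word_prod.
  apply/esym/all_filterP/allP => i iw; rewrite /nonlast.
  by case: (ltngtP i.+1 r) (ltn_ord i) => // ir _; case: (nf i ir); exists w.
split; first by have [w _ E] := perm_mx_word s; exists w.
move=> i ir [w [E min] iw].
have [d [s' [E1 E2]]] := word_prod_signed_perm w.
have [_ ss'] : (fun=> false) =1 d /\ s = s'.
  by apply: signed_perm_mx_inj; rewrite signed_perm_mx_pos -E -E1.
have := min (filter (@nonlast r) w); rewrite E2 -ss' => /(_ erefl).
rewrite size_filter leqNgt ltn_neqAle count_size -all_count andbT => /negP.
by apply; apply/negP => /allP /(_ i iw); rewrite /nonlast ir ltnn.
Qed.

(** * The excess of a signed permutation *)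

(** The coordinates of the highest root plus [rho], as natural numbers. *)
Definition weight r (i : nat) : nat := r - i + (i == 0%N).*2.

Definition excess r (d : 'I_r -> bool) (s : 'S_r) (k : nat) : rat :=
  \sum_(i < r | (i < k)%N) ((-1) ^+ d i * (weight r (s i))%:R - (r - i)%:R).

Definition dominating r : set 'S_r :=
  [set s : 'S_r | forall k, 0 <= excess (fun=> false) s k].

Lemma shifted_weightE r d (s : 'S_r) i :
  (signed_perm_mx d s *m (highest_root r + rho r) - rho r) i ord0 =
  (-1) ^+ d i * (weight r (s i))%:R - (r - i)%:R.
Proof.
rewrite mxE [X in _ + X]mxE rhoE signed_perm_mx_mulv mxE highest_rootE rhoE.
by rewrite -natrD addnC.
Qed.

Lemma prefix_excess r d (s : 'S_r) k :
  prefix k (signed_perm_mx d s *m (highest_root r + rho r) - rho r) =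
  excess d s k.
Proof. by apply: eq_bigr => i _; exact: shifted_weightE. Qed.

Lemma excessS r d (s : 'S_r) (i : 'I_r) : excess d s i.+1 =
  excess d s i + ((-1) ^+ d i * (weight r (s i))%:R - (r - i)%:R).
Proof. by rewrite -!prefix_excess prefixS shifted_weightE. Qed.

(** The unsigned coordinates of the highest root plus [rho] sum to 2 more than
    those of [rho], and each negation costs twice the negated entry. *)
Lemma excess_total r d (s : 'S_r) : (0 < r)%N ->
  excess d s r = 2 - 2 * (\sum_(i | d i) weight r (s i))%:R.
Proof.
move=> r0; have W : (\sum_(i < r) weight r (s i) = \sum_(i < r) (r - i) + 2)%N.
  transitivity (\sum_(i < r) weight r i)%N.
    by rewrite [RHS](reindex_inj (@perm_inj _ s)).
  rewrite big_split /=; congr addn.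
  rewrite (bigD1 (Ordinal r0)) //= big1 // => i.
  by rewrite -val_eqE /= => /negbTE ->.
have {}W :
    \sum_(i < r) (weight r (s i))%:R - \sum_(i < r) (r - i)%:R = 2 :> rat.
  by rewrite -!natr_sum W natrD addrC addKr.
rewrite -{1}W natr_sum mulr_sumr [X in _ = _ - X]big_mkcond -!sumrB /excess.
apply: eq_big => [i|i _]; first exact: ltn_ord.
by case: (d i); rewrite ?expr1 ?expr0 /=; lra.
Qed.

Lemma alternation_setP r d (s : 'S_r) : (0 < r)%N ->
  alternation_set r (signed_perm_mx d s) <->
  weyl r (signed_perm_mx d s) /\ forall k, 0 <= excess d s k.
Proof.
move=> r0; rewrite /alternation_set /= kostant_gt0_prefix.
- by split=> -[Ws H]; split=> // k; rewrite ?prefix_excess // -prefix_excess.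
- move=> i; rewrite shifted_weightE.
  by rewrite rpredB ?rpredM ?rpredX ?rpredN ?rpred1 ?natr_int.
- rewrite prefix_excess excess_total // mulrBl divff // mulrAC divff // mul1r.
  by rewrite rpredB ?rpred1 ?natr_int.
Qed.

(** The convention [P_1 = {1}] fits: in rank 1 there is a single permutation,
    and it is dominating. *)
Lemma P_setE r : (0 < r)%N -> P_set r = [set perm_mx s | s in @dominating r].
Proof.
move=> r0; rewrite /P_set; case: eqP => [r1|_].
  subst r; apply/seteqP; split=> [_ /= ->|_ [s _ <-] /=].
    exists 1%g; last by rewrite perm_mx1.
    move=> k; apply: sumr_ge0 => i _; rewrite mul1r subr_ge0 ler_nat perm1.
    by rewrite leq_addr.
  suff -> : s = 1%g by rewrite perm_mx1.
  by apply/permP => i; rewrite !ord1.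
apply/seteqP; split=> [sigma [altS nf]|_ [s sD <-]].
  have [s E] : exists s : 'S_r, sigma = perm_mx s.
    by apply/no_last_factor; split=> //; case: altS.
  exists s => //; move: altS; rewrite E -signed_perm_mx_pos.
  by case/alternation_setP.
have [Ws nf] : weyl r (perm_mx s) /\
    forall i : 'I_r, i.+1 = r -> ~ contains_factor (perm_mx s : 'M_r) i.
  by apply/no_last_factor; exists s.
split=> //; move: Ws; rewrite -signed_perm_mx_pos => Ws.
exact/alternation_setP.
Qed.

Lemma weight_le1 n (i : 'I_n.+1) : (weight n.+1 i <= 1)%N -> i = ord_max.
Proof.
move=> wi; apply: val_inj; have := ltn_ord i; move: wi; rewrite /weight /=.
by case: eqP => [->|] /=; lia.
Qed.

(** Nonnegativity of the total excess bounds the sum of the negated entries by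
    1, so a negated entry is the entry 1 and is unique. The total excess is then
    0, and nonnegativity of the excess one step before says that the last
    coordinate is at most 1: its entry is 1, or it is negated. Both mean that
    the negated entry is there. *)
Lemma excess_negative n d (s : 'S_n.+1) j :
  (forall k, 0 <= excess d s k) -> d j ->
  d =1 pred1 ord_max /\ s ord_max = ord_max.
Proof.
move=> ge0 dj; have := ge0 n.+1; rewrite excess_total //.
set W := (\sum_(i | d i) _)%N => W1.
have {}W1 : (W <= 1)%N by rewrite -(ler_nat rat); lra.
have w0 (i : 'I_n.+1) : (0 < weight n.+1 i)%N.
  by have := ltn_ord i; rewrite /weight; lia.
have wj : (weight n.+1 (s j) <= 1)%N.
  by apply: leq_trans W1; rewrite /W (bigD1 j) //= leq_addr.
have sj := weight_le1 wj.
have d1 : d =1 pred1 j.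
  move=> i /=; case: eqP => [->//|/eqP ij]; apply/negP => di.
  move: W1; rewrite /W (bigD1 j) //= (bigD1 i) ?di //=.
  by have := w0 (s i); have := w0 (s j); lia.
have W_1 : W = 1%N.
  by rewrite /W (eq_bigl _ _ d1) big_pred1_eq; have := w0 (s j); lia.
have tot : excess d s n.+1 = 0 by rewrite excess_total // -/W W_1 subrr.
suff jE : j = ord_max by move: d1 sj; rewrite jE.
have [|dn] := boolP (d ord_max); first by rewrite d1 /= => /eqP/esym.
apply: (@perm_inj _ s); rewrite sj; apply/esym/weight_le1.
move: tot (ge0 n); rewrite (excessS d s ord_max) (negbTE dn) mul1r subSnn /=.
by rewrite -(ler_nat rat); lra.
Qed.

(** * Stripping a negated last entry *)

Lemma excess_out r d (s : 'S_r) k : (r <= k)%N -> excess d s k = excess d s r.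
Proof. by move=> rk; rewrite -!prefix_excess prefix_out. Qed.

(** Away from the last place, raising the rank by one adds 1 to the entries of
    both vectors that are compared. *)
Lemma excess_lift n (s : 'S_n) k : (k <= n)%N ->
  excess (pred1 ord_max) (lift_perm ord_max ord_max s) k =
  excess (fun=> false) s k.
Proof.
move=> kn; rewrite /excess big_mkcond big_ord_recr -big_mkcond /=.
rewrite ltnNge kn addr0.
apply: eq_bigr => i _.
have -> : widen_ord (leqnSn n) i = lift ord_max i.
  by apply: val_inj; rewrite [RHS]lift_max.
rewrite lift_perm_lift (eq_sym _ ord_max) (negbTE (neq_lift _ _)).
rewrite !lift_max.
have wS x : (x < n)%N -> weight n.+1 x = (weight n x).+1.
  by rewrite /weight => xn; lia.
rewrite wS // subSn 1?ltnW // !mul1r.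
by rewrite !mulrSr; lra.
Qed.

(** [lift_perm ord_max ord_max] identifies the symmetric group of one degree
    less with the stabilizer of the last point. *)
Lemma lift_perm_ex n (s : 'S_n.+1) : s ord_max = ord_max ->
  exists s' : 'S_n, s = lift_perm ord_max ord_max s'.
Proof.
move=> sm.
have h (i : 'I_n) : {j | s (lift ord_max i) = lift ord_max j}.
  case: (unliftP ord_max (s (lift ord_max i))) => [j ->|]; first by exists j.
  rewrite -{2}sm => /perm_inj/eqP; rewrite eq_sym.
  by rewrite (negbTE (neq_lift _ _)).
have f_inj : injective (fun i => sval (h i)).
  move=> i j E; apply: (@lift_inj _ ord_max); apply: (@perm_inj _ s).
  by rewrite (svalP (h i)) (svalP (h j)) E.
exists (perm f_inj); apply/permP => i; case: (unliftP ord_max i) => [j|] ->.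
  by rewrite lift_perm_lift permE; exact: (svalP (h j)).
by rewrite lift_perm_id.
Qed.

(** The block diagonal matrix with blocks [perm_mx s] and [-1]. *)
Definition ext_perm_mx n (s : 'S_n) : 'M[rat]_n.+1 :=
  signed_perm_mx (pred1 ord_max) (lift_perm ord_max ord_max s).

(** Beyond the prefixes covered by [excess_lift] there is only the total excess,
    which is 0 because the negated entry is 1. *)
Lemma alternation_set_ext n (s : 'S_n) : (0 < n)%N ->
  alternation_set n.+1 (ext_perm_mx s) <-> dominating s.
Proof.
move=> n0; rewrite /ext_perm_mx alternation_setP //; split=> [[_ ge0] k|sD].
  case: (leqP k n) => kn; first by rewrite -excess_lift.
  by rewrite excess_out 1?ltnW // -excess_lift.
split=> [|k].
  have [w _ E] := perm_mx_word (lift_perm ord_max ord_max s).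
  exists (ord_max :: w) => //.
  rewrite word_prod_cons E srefl_last // -signed_perm_mx_pos signed_perm_mxM.
  by rewrite mul1g; apply/matrixP => i j; rewrite !mxE addbF.
case: (leqP k n) => kn; first by rewrite excess_lift.
rewrite excess_out // excess_total // big_pred1_eq lift_perm_id.
by rewrite /weight subSnn /= (gtn_eqF n0) /= subrr.
Qed.

Lemma alternation_set_split n : (0 < n)%N ->
  alternation_set n.+1 =
  P_set n.+1 `|` [set ext_perm_mx s | s in @dominating n].
Proof.
move=> n0; rewrite P_setE //; apply/seteqP; split=> [sigma sC|_ [] [s sD <-]].
- have [w _ E] := proj1 sC; have [d [s [E1 _]]] := word_prod_signed_perm w.
  rewrite -E E1 in sC *; have [_ ge0] := (alternation_setP d s isT).1 sC.
  case: (pickP d) => [j dj|d0]; last first.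
    have {}d0 : d = fun=> false by apply/funext.
    by left; exists s; rewrite d0 ?signed_perm_mx_pos // in ge0 *.
  have [/funext d1 /lift_perm_ex[s' E']] := excess_negative ge0 dj.
  rewrite d1 E' -/(ext_perm_mx s') in sC *.
  by right; exists s' => //; apply/alternation_set_ext.
- rewrite -signed_perm_mx_pos; apply/alternation_setP => //; split=> //.
  rewrite signed_perm_mx_pos.
  by apply: (proj1 ((no_last_factor _).2 _)); exists s.
- exact/alternation_set_ext.
Qed.

(** * Counting *)

Lemma perm_mx_rat_inj r : injective (fun s : 'S_r => perm_mx s : 'M[rat]_r).
Proof.
move=> s t; rewrite -!signed_perm_mx_pos => E.
by have [] := signed_perm_mx_inj E.
Qed.

Lemma ext_perm_mx_inj n : injective (@ext_perm_mx n).
Proof.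
move=> s t /signed_perm_mx_inj[_ /permP E]; apply/permP => i.
by have := E (lift ord_max i); rewrite !lift_perm_lift => /lift_inj.
Qed.

Lemma card_fset_set_image (T : finType) (K : choiceType) (f : T -> K)
    (A : set T) : injective f -> #|` fset_set (f @` A)| = #|` fset_set A|.
Proof.
by move=> fI; rewrite fset_set_image ?card_imfset //; exact: finite_finset.
Qed.

Lemma card_fset_setU_disjoint (K : choiceType) (A B : set K) :
  finite_set A -> finite_set B -> A `&` B = set0 ->
  #|` fset_set (A `|` B)| = (#|` fset_set A| + #|` fset_set B|)%N.
Proof.
move=> Af Bf AB; rewrite fset_setU // cardfsU -fset_setI // AB fset_set0.
by rewrite cardfs0 subn0.
Qed.

Lemma perm_mx_ext_disjoint n :
  [set perm_mx s | s in @dominating n.+1] `&`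
  [set ext_perm_mx s | s in @dominating n] = set0.
Proof.
apply/seteqP; split=> // _ [[s _ <-] [t _ /esym]].
rewrite -signed_perm_mx_pos => /signed_perm_mx_inj[/(_ ord_max)].
by rewrite /= eqxx.
Qed.

End WeylAlternation.

Theorem corollary5p12 (r : nat) (hr : (2 <= r)%N) :
  #|` fset_set (alternation_set r)| =
    (#|` fset_set (P_set r)| + #|` fset_set (P_set r.-1)|)%N.
Proof.
case: r hr => [//|n] n0; rewrite alternation_set_split //= !P_setE //.
rewrite card_fset_setU_disjoint; first last.
- exact: perm_mx_ext_disjoint.
- exact/finite_image/finite_finset.
- exact/finite_image/finite_finset.
congr addn; rewrite (card_fset_set_image _ (@ext_perm_mx_inj n)).
by rewrite (card_fset_set_image _ (@perm_mx_rat_inj n)).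
Qed.
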